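(* Let $p$ be the mesh pattern $(12,R)$ with $R=\{(0,0),(0,1),(1,1),(1,2),(2,0),(2,1)\}$, let $E(t,u)=\sum_{n\ge0}t^n\sum_{\sigma\in K_n}u^{p(\sigma)}$, and let $P(t)=\sum_{n\ge0}|K_n(p)|t^n$. Then $$P(t)=\frac{(1+t)\big(A(t)-t\big)}{1+t\big(A(t)-t-1\big)},\qquad E(t,u)=\frac{(1+t)\big(t(1-u)-(1-ut)A(t)\big)}{-1+t\big(1-u+t-(1-u)A(t)\big)}.$$ The initial terms of $E(t,u)$ are $1+t+2t^4+14t^5+(88+2u)t^6+(632+14u)t^7+(5152+88u+2u^2)t^8+\cdots$.
   Context: A permutation $\sigma=\sigma_1\cdots\sigma_n$ of $\{1,\dots,n\}$ is a king permutation if $|\sigma_{i+1}-\sigma_i|>1$ for all $1\le i\le n-1$. $K_n$ is the set of king permutations of length $n$ ($K_0$ = the empty permutation, $K_1=\{1\}$) and $A(t)=\sum_{n\ge0}|K_n|t^n$ (known to equal $\sum_{n\ge0}n!\,t^n(1-t)^n/(1+t)^n$). For a mesh pattern $p=(12,R)$ with $R\subseteq\{0,1,2\}^2$, an occurrence of $p$ in $\sigma\in S_n$ is a pair of positions $i_1<i_2$ with $\sigma_{i_1}<\sigma_{i_2}$ such that for every $(x,y)\in R$ there is no position $m$ with $i_x<m<i_{x+1}$ and $v_y<\sigma_m<v_{y+1}$, where $i_0=0$, $i_3=n+1$, $v_0=0$, $v_1=\sigma_{i_1}$, $v_2=\sigma_{i_2}$, $v_3=n+1$ (first coordinate of a box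 indexes positions, second values). $p(\sigma)$ is the number of occurrences of $p$ in $\sigma$; $K_n(p)$ is the set of king $n$-permutations with $p(\sigma)=0$. *)

(* Defs.v *)
From HB Require Import structures.
From mathcomp Require Import all_boot all_order all_algebra all_fingroup.
From mathcomp Require Import boolp.

Set Implicit Arguments.
Unset Strict Implicit.
Unset Printing Implicit Defensive.

Import Order.TTheory GRing.Theory Num.Theory.
Local Open Scope ring_scope.

Record fps (R : Type) : Type := FPS { fps_coef : nat -> R }.

Lemma fpsP (R : Type) (f g : fps R) :
  (forall n, fps_coef f n = fps_coef g n) -> f = g.
Proof. by case: f g => [f] [g] /= fg; congr FPS; apply: funext. Qed.

HB.instance Definition _ (R : Type) := gen_eqMixin (fps R).
HB.instance Definition _ (R : Type) := gen_choiceMixin (fps R).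

Section FpsRing.
Variable R : comNzRingType.
Implicit Types f g h : fps R.

Definition fps0 : fps R := FPS (fun=> 0).
Definition fps1 : fps R := FPS (fun n => (n == 0%N)%:R).
Definition fps_opp f : fps R := FPS (fun n => - fps_coef f n).
Definition fps_add f g : fps R := FPS (fun n => fps_coef f n + fps_coef g n).
Definition fps_mul f g : fps R :=
  FPS (fun n => \sum_(i < n.+1) fps_coef f i * fps_coef g (n - i)%N).

Fact fps_addA : associative fps_add.
Proof. by move=> f g h; apply: fpsP => n /=; rewrite addrA. Qed.
Fact fps_addC : commutative fps_add.
Proof. by move=> f g; apply: fpsP => n /=; rewrite addrC. Qed.
Fact fps_add0 : left_id fps0 fps_add.
Proof. by move=> f; apply: fpsP => n /=; rewrite add0r. Qed.
Fact fps_addN : left_inverse fps0 fps_opp fps_add.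
Proof. by move=> f; apply: fpsP => n /=; rewrite addNr. Qed.

HB.instance Definition _ :=
  GRing.isZmodule.Build (fps R) fps_addA fps_addC fps_add0 fps_addN.

Let trunc m f : {poly R} := \poly_(i < m.+1) fps_coef f i.

Let coef_trunc m f i : (i <= m)%N -> (trunc m f)`_i = fps_coef f i.
Proof. by move=> im; rewrite coef_poly ltnS im. Qed.

Let fps_mul_trunc m f g n : (n <= m)%N ->
  fps_coef (fps_mul f g) n = (trunc m f * trunc m g)`_n.
Proof.
move=> nm /=; rewrite coefM; apply: eq_bigr => i _.
have im : (i <= m)%N by rewrite (leq_trans _ nm) // -ltnS.
by rewrite !coef_trunc // (leq_trans (leq_subr _ _) nm).
Qed.

Fact fps_mulC : commutative fps_mul.
Proof. by move=> f g; apply: fpsP => n; rewrite !(@fps_mul_trunc n) // mulrC. Qed.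

Fact fps_mulA : associative fps_mul.
Proof.
move=> f g h; apply: fpsP => n.
transitivity ((trunc n f * (trunc n g * trunc n h))`_n).
  rewrite coefM /=; apply: eq_bigr => i _.
  have im : (i <= n)%N by rewrite -ltnS.
  by rewrite coef_trunc // -(fps_mul_trunc _ _ (leq_subr _ _)).
rewrite mulrA coefM /=; apply: eq_bigr => i _.
have im : (i <= n)%N by rewrite -ltnS.
by rewrite -(fps_mul_trunc _ _ im) coef_trunc // leq_subr.
Qed.

Fact fps_mul1 : left_id fps1 fps_mul.
Proof.
move=> f; apply: fpsP => n /=.
by rewrite big_ord_recl /= mul1r subn0 big1 ?addr0 // => i _; rewrite mul0r.
Qed.

Fact fps_mulD : left_distributive fps_mul fps_add.
Proof.
move=> f g h; apply: fpsP => n /=; rewrite -big_split.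
by apply: eq_bigr => i _; rewrite mulrDl.
Qed.

Fact fps_oner_neq0 : fps1 != 0.
Proof.
apply/eqP => /(congr1 (fun f : fps R => fps_coef f 0)) /= /eqP.
by rewrite oner_eq0.
Qed.

HB.instance Definition _ := GRing.Zmodule_isComNzRing.Build (fps R)
  fps_mulA fps_mulC fps_mul1 fps_mulD fps_oner_neq0.

Definition fpsC (c : R) : fps R := FPS (fun n => if n == 0%N then c else 0).
Definition fpsX : fps R := FPS (fun n => (n == 1%N)%:R).

End FpsRing.

Section FpsUnitRing.
Variable R : comUnitRingType.
Implicit Types f g : fps R.

Definition fps_unit : pred (fps R) := fun f => fps_coef f 0 \is a GRing.unit.

(* [fps_inv_seq f n] lists the coefficients g_0, ..., g_n of 1/f, from
   g_0 = 1/f_0 and g_n = - (1/f_0) * \sum_(i < n) g_i * f_(n-i). *)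
Fixpoint fps_inv_seq f (n : nat) : seq R :=
  if n is n'.+1 then
    let s := fps_inv_seq f n' in
    rcons s (- (fps_coef f 0)^-1 * \sum_(i < n) s`_i * fps_coef f (n - i)%N)
  else [:: (fps_coef f 0)^-1].

(* As for every [unitRingType], the inverse of a non-unit is itself. *)
Definition fps_inv f : fps R :=
  if fps_unit f then FPS (fun n => (fps_inv_seq f n)`_n) else f.

Let size_fps_inv_seq f n : size (fps_inv_seq f n) = n.+1.
Proof. by elim: n => //= n IHn; rewrite size_rcons IHn. Qed.

Let nth_fps_inv_seq f n i : (i <= n)%N ->
  (fps_inv_seq f n)`_i = (fps_inv_seq f i)`_i.
Proof.
elim: n => [|n IHn]; first by rewrite leqn0 => /eqP->.
rewrite leq_eqVlt ltnS => /predU1P[->//|le_in] /=.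
by rewrite nth_rcons size_fps_inv_seq ltnS le_in IHn.
Qed.

Fact fps_mulVx : {in fps_unit, left_inverse 1 fps_inv *%R}.
Proof.
move=> f fU; have fU0 : fps_coef f 0 \is a GRing.unit by [].
apply: fpsP => n; rewrite /fps_inv (fU : fps_unit f).
case: n => [|n]; first by rewrite /= big_ord1 mulVr.
rewrite [LHS]/= big_ord_recr /= subnn.
rewrite nth_rcons size_fps_inv_seq ltnn eqxx mulrAC mulNr mulVr // mulN1r.
apply/eqP; rewrite subr_eq0; apply/eqP/eq_bigr => i _.
by rewrite (@nth_fps_inv_seq f n) // -ltnS.
Qed.

Fact fps_unitPl (f g : fps R) : g * f = 1 -> fps_unit f.
Proof.
move=> /(congr1 (fun h : fps R => fps_coef h 0)) /=.
rewrite big_ord1 => gf; apply/unitrPr; exists (fps_coef g 0).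
by rewrite mulrC.
Qed.

Fact fps_inv_out : {in [predC fps_unit], fps_inv =1 id}.
Proof. by move=> f nU; rewrite /fps_inv (negPf (nU : ~~ fps_unit f)). Qed.

HB.instance Definition _ := GRing.ComNzRing_hasMulInverse.Build (fps R)
  fps_mulVx fps_unitPl fps_inv_out.

Lemma fps_unitE f : (f \is a GRing.unit) = (fps_coef f 0 \is a GRing.unit).
Proof. by []. Qed.

End FpsUnitRing.

(* A permutation of {1, ..., n} is represented by s : 'S_n acting on
   {0, ..., n-1}: its i-th letter is (s (i-1)).+1. *)
Definition king n (s : 'S_n) : bool :=
  [forall i : 'I_n, forall j : 'I_n,
    (j == i.+1 :> nat) ==> (1 < `|(s j)%:Z - (s i)%:Z|)].

Definition kings n : {set 'S_n} := [set s | king s].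

(* The positions i_0, ..., i_3 (resp. the values v_0, ..., v_3) delimiting the
   columns (resp. rows) of the boxes; a and b are 0-based. *)
Definition mesh_line n (a b : 'I_n) (k : nat) : nat :=
  nth 0%N [:: 0%N; a.+1; b.+1; n.+1] k.

Definition mesh12_occ (R : {set 'I_3 * 'I_3}) n (s : 'S_n) (i1 i2 : 'I_n) :=
  [&& (i1 < i2)%N, (s i1 < s i2)%N &
   [forall b in R, forall m : 'I_n,
     ~~ ((mesh_line i1 i2 b.1 < m.+1 < mesh_line i1 i2 b.1.+1)%N &&
         (mesh_line (s i1) (s i2) b.2 < (s m).+1
            < mesh_line (s i1) (s i2) b.2.+1)%N)]].

Definition mesh12_count (R : {set 'I_3 * 'I_3}) n (s : 'S_n) : nat :=
  #|[set i : 'I_n * 'I_n | mesh12_occ R s i.1 i.2]|.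

Definition kings_avoiding (R : {set 'I_3 * 'I_3}) n : {set 'S_n} :=
  [set s in kings n | mesh12_count R s == 0%N].

Definition box (x y : nat) : 'I_3 * 'I_3 := (inord x, inord y).

Definition shading : {set 'I_3 * 'I_3} :=
  [set box 0 0; box 0 1; box 1 1; box 1 2; box 2 0; box 2 1].

Definition A_series (S : comNzRingType) : fps S := FPS (fun n => #|kings n|%:R).

Definition P_series (S : comNzRingType) (R : {set 'I_3 * 'I_3}) : fps S :=
  FPS (fun n => #|kings_avoiding R n|%:R).

(* The variable u is the indeterminate of {poly int}, so that E(t,u) belongs to
   Z[u][[t]]. *)
Definition E_series (R : {set 'I_3 * 'I_3}) : fps {poly int} :=
  FPS (fun n => \sum_(s in kings n) 'X ^+ mesh12_count R s).

(* Main.v *)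
Require Import Defs.
From mathcomp Require Import all_boot all_order all_algebra all_fingroup.
From mathcomp Require Import zify ring.
Import GRing.Theory.

(* Every value strictly between those of an occurrence would lie in a shaded
   box, so an occurrence takes values [k] and [k.+1] (0-based), and the entries
   between them are exactly those smaller than [k].  Occurrences are thus nested
   and, with [p] the total number of occurrences,
     u ^ p = 1 + (u - 1) * \sum_(o) u ^ (number of occurrences inside o).
   An occurrence cuts a king permutation into the middle part m, a nonempty king
   permutation of size [k] not starting with its maximum, and the permutation w
   obtained by contracting the whole block [k, m, k.+1] to its minimum; w is king
   except that the factor "1 0" is allowed.  Hence, for the corresponding
   generating functions M(t,u) and Q(t),
     E = A + (u - 1) t M Q.
   Removing a leading maximum gives E = (1 + t) (1 + M), and contracting the
   factor "1 0", followed by reversal, gives Q = A - 1 + t Q. *)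

Set Implicit Arguments.
Unset Strict Implicit.
Unset Printing Implicit Defensive.
Local Open Scope nat_scope.

(** * Inflating the minimum of a word into a block, and contracting it back *)

(* The letter 0 of [w] is replaced by the word [B], a permutation of
   [{0, ..., c}] in all uses; [defl c] undoes this. *)
Definition infl c (B w : seq nat) :=
  flatten [seq if v == 0 then B else [:: c + v] | v <- w].

Definition defl c (s : seq nat) := [seq v - c | v <- s & c <= v].

Lemma defl_cat c s1 s2 : defl c (s1 ++ s2) = defl c s1 ++ defl c s2.
Proof. by rewrite /defl filter_cat map_cat. Qed.

Lemma perm_defl c s1 s2 : perm_eq s1 s2 -> perm_eq (defl c s1) (defl c s2).
Proof. by move=> s12; apply/perm_map/perm_filter. Qed.

Lemma defl_iota c m : defl c (iota 0 (c + m)) = iota 0 m.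
Proof.
rewrite iotaD defl_cat -[0 + c]addn0 iotaDl /defl.
rewrite (_ : filter _ (iota 0 c) = [::]); last first.
  by apply/eqP; rewrite -size_eq0 size_filter -leqn0 leqNgt -has_count -all_predC;
     apply/allP => v; rewrite mem_iota /= -ltnNge.
rewrite (all_filterP _); last by apply/allP => v /mapP[j _ ->]; lia.
by rewrite /= -map_comp map_id_in // => v _ /=; lia.
Qed.

Lemma defl_block c B : perm_eq B (iota 0 c.+1) -> defl c B = [:: 0].
Proof.
move=> /(perm_defl c); rewrite -addn1 defl_iota => Bp.
by apply/perm_small_eq.
Qed.

Lemma inflK c B : perm_eq B (iota 0 c.+1) -> cancel (infl c B) (defl c).
Proof.
move=> /defl_block dB; elim=> //= v w IHw.
rewrite /infl /= defl_cat -/(infl c B w) IHw.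
by case: v => [|v]; rewrite ?dB //= /defl /= leq_addr /= addKn.
Qed.

Lemma infl_pos c B x : 0 \notin x -> infl c B x = [seq c + v | v <- x].
Proof.
elim: x => //= v x IHx; rewrite inE negb_or => /andP[v0 x0].
by rewrite /infl /= -/(infl c B x) IHx // eq_sym (negPf v0).
Qed.

Lemma infl_split c B x y : 0 \notin x -> 0 \notin y ->
  infl c B (x ++ 0 :: y) = [seq c + v | v <- x] ++ B ++ [seq c + v | v <- y].
Proof.
by move=> x0 y0; rewrite /infl map_cat flatten_cat /= -!/(infl _ _ _) !infl_pos.
Qed.

Lemma uniq_split (T : eqType) (a : T) w : a \in w -> uniq w ->
  exists x y, [/\ w = x ++ a :: y, a \notin x & a \notin y].
Proof.
case/splitPr => x y; rewrite cat_uniq /= negb_or -!andbA => /and5P[_ ax _ ay _].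
by exists x, y.
Qed.

Lemma iota_split m w : perm_eq w (iota 0 m.+1) ->
  exists x y, [/\ w = x ++ 0 :: y, 0 \notin x & 0 \notin y].
Proof.
move=> wp; apply: uniq_split; first by rewrite (perm_mem wp) mem_iota.
by rewrite (perm_uniq wp) iota_uniq.
Qed.

Lemma perm_infl c B m w : perm_eq B (iota 0 c.+1) -> perm_eq w (iota 0 m.+1) ->
  perm_eq (infl c B w) (iota 0 (c + m.+1)).
Proof.
move=> Bp wp; have [x [y [wE x0 y0]]] := iota_split wp.
rewrite wE infl_split // perm_catCA -map_cat addnS -addSn iotaD.
apply: perm_cat => //; rewrite add0n -addn1 iotaDl; apply: perm_map.
by move: wp; rewrite wE -[0 :: y]cat1s perm_catCA /= perm_cons.
Qed.

(** [B] uses up the letters [0, ..., c], so every letter of [x] and [y] exceeds [c] and survives the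
    truncated subtraction. *)
Lemma deflK c B x y m : perm_eq B (iota 0 c.+1) ->
  perm_eq (x ++ B ++ y) (iota 0 (c + m.+1)) ->
  infl c B (defl c (x ++ B ++ y)) = x ++ B ++ y.
Proof.
move=> Bp sp; have: uniq (x ++ B ++ y) by rewrite (perm_uniq sp) iota_uniq.
rewrite (perm_uniq (_ : perm_eq _ (B ++ x ++ y))); last first.
  by rewrite perm_catCA.
rewrite cat_uniq has_cat => /and3P[_ /norP[xB yB] _].
have big z : ~~ has (mem B) z -> all (fun v => c < v) z.
  move=> zB; apply/allP=> v vz; rewrite ltnNge; apply: contra zB => vc.
  by apply/hasP; exists v => //=; rewrite (perm_mem Bp) mem_iota.
have deflE z : all (fun v => c < v) z -> defl c z = [seq v - c | v <- z].
  by rewrite /defl => zc; rewrite (all_filterP _) //; apply: sub_all zc => v /ltnW.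
rewrite !defl_cat (defl_block Bp) /= !deflE ?big // infl_split.
- rewrite -!map_comp; congr (_ ++ (_ ++ _)); apply: map_id_in => v /= vz.
    by rewrite subnKC // ltnW // (allP (big _ xB)).
  by rewrite subnKC // ltnW // (allP (big _ yB)).
- by apply/negP => /mapP[v vx]; have := allP (big _ xB) v vx; lia.
- by apply/negP => /mapP[v vx]; have := allP (big _ yB) v vx; lia.
Qed.

Lemma sorted_cat_block (T : Type) (r : rel T) x b B y :
  sorted r (x ++ (b :: B) ++ y) =
  [&& sorted r (rcons x b), path r b B & path r (last b B) y].
Proof. by rewrite sorted_cat_cons cat_path. Qed.

(** Adjacencies inside the block hold by assumption, and those of shifted letters match adjacencies
    of [w]. The two at the ends of the block become adjacencies with 0, so [r'] treats entering and
    leaving 0 separately. *)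
Lemma sorted_infl (r r' : rel nat) c b B w m :
  path r b B -> perm_eq w (iota 0 m.+1) ->
  (forall v v', 0 < v -> 0 < v' -> r (c + v) (c + v') = r' v v') ->
  (forall v, 0 < v -> r (c + v) b = r' v 0) ->
  (forall v, 0 < v -> r (last b B) (c + v) = r' 0 v) ->
  sorted r (infl c (b :: B) w) = sorted r' w.
Proof.
move=> bB wp rr rb rl; have [x [y [-> x0 y0]]] := iota_split wp.
rewrite infl_split // sorted_cat_block bB /= sorted_cat_cons.
have pos z : 0 \notin z -> all [pred v | 0 < v] z.
  by move=> z0; apply/allP=> v vz /=; case: v vz z0 => // ->.
have pathE v z : 0 < v -> 0 \notin z ->
    path r (c + v) [seq c + i | i <- z] = path r' v z.
  move=> v0 /pos z0; rewrite path_map.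
  by apply: (@eq_in_path _ [pred v | 0 < v]); rewrite /= ?v0 //= => i j *; apply: rr.
congr (_ && _).
  case: x x0 => // a x ax0; have /andP[a0 x0] := pos _ ax0.
  rewrite /= !rcons_path pathE //; last by case/norP: ax0.
  by rewrite last_map rb // ; have /allP := pos _ ax0; apply; apply: mem_last.
case: y y0 => //= a y ay0; have /andP[/= a0 _] := pos _ ay0.
by rewrite rl // pathE //; case/norP: ay0.
Qed.

(** * King words, and king words with one exceptional adjacency *)

Definition far x y := (x.+1 < y) || (y.+1 < x).
(** Contracting a block that starts with [k] and ends with [k.+1] can create the factor [1 0], as
    [k.+2] is far from [k], but not [0 1], as [k.+2] is too close to [k.+1]. *)
Definition far10 x y := far x y || (x == 1) && (y == 0).
Definition far01 x y := far x y || (x == 0) && (y == 1).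

Definition sperms (r : rel nat) n :=
  [seq s <- permutations (iota 0 n) | sorted r s].

Lemma mem_sperms r n s :
  (s \in sperms r n) = sorted r s && perm_eq s (iota 0 n).
Proof. by rewrite mem_filter mem_permutations. Qed.

Lemma sperms_uniq r n : uniq (sperms r n).
Proof. by rewrite filter_uniq // permutations_uniq. Qed.

Lemma sperms_rev r n : size (sperms r n) = size (sperms (fun x y => r y x) n).
Proof.
have /perm_size <- : perm_eq [seq rev s | s <- sperms (fun x y => r y x) n]
    (sperms r n); last by rewrite size_map.
apply: uniq_perm; rewrite ?sperms_uniq ?(map_inj_uniq (can_inj revK)) ?sperms_uniq //.
move=> s; rewrite mem_sperms -{1}[s]revK (mem_map (can_inj revK)).
by rewrite mem_sperms rev_sorted perm_rev.
Qed.

Lemma far_sym x y : far x y = far y x.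
Proof. exact: orbC. Qed.

Lemma eq_sperms r r' n : r =2 r' -> sperms r n = sperms r' n.
Proof. by move=> rr; apply: eq_filter => s; apply: eq_sorted. Qed.

Lemma size_sperms_far01 n : size (sperms far01 n) = size (sperms far10 n).
Proof.
rewrite sperms_rev; congr size; apply: eq_sperms => x y.
by rewrite /far01 /far10 far_sym andbC.
Qed.

Lemma far10_split s : sorted far10 s -> ~~ sorted far s ->
  exists x y, s = x ++ [:: 1; 0] ++ y.
Proof.
case: s => //= a s; elim: s a => //= b s IHs a /andP[ab bs].
rewrite negb_and; case/orP => [nab|/IHs]; last first.
  by move=> /(_ bs)[x [y ->]]; exists (a :: x), y.
move: ab; rewrite /far10 (negPf nab) /= => /andP[/eqP-> /eqP->].
by exists [::], s.
Qed.

(** Words without the factor [1 0] are the king words. In the others, contract [1 0] to 0: before it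
    2 is too close to 1, after it 2 is far from 0, so exactly [0 1] becomes allowed. Reversal turns
    [far01] back into [far10]. *)
Lemma size_sperms_far10 m :
  size (sperms far10 m.+2) = size (sperms far m.+2) + size (sperms far10 m.+1).
Proof.
rewrite -(count_predC (sorted far) (sperms far10 m.+2)) -size_sperms_far01.
congr (_ + _).
  rewrite -size_filter /sperms -filter_predI; congr size; apply: eq_filter => s /=.
  by apply: andb_idr; apply: sub_sorted => x y xy; rewrite /far10 xy.
rewrite -size_filter.
have Bp : perm_eq [:: 1; 0] (iota 0 2) by [].
have /perm_size <- : perm_eq [seq infl 1 [:: 1; 0] w | w <- sperms far01 m.+1]
    (filter (predC (sorted far)) (sperms far10 m.+2)); last by rewrite size_map.
have srt w : perm_eq w (iota 0 m.+1) ->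
    sorted far10 (infl 1 [:: 1; 0] w) = sorted far01 w.
  move=> wp; apply: (sorted_infl _ wp) => //.
  - by move=> v v' v0 v'0; rewrite /far10 /far01 /far; lia.
  - by move=> v v0; rewrite /far10 /far01 /far /=; lia.
apply: uniq_perm.
- by rewrite (map_inj_uniq (can_inj (inflK Bp))) sperms_uniq.
- by rewrite filter_uniq // sperms_uniq.
move=> s; rewrite mem_filter mem_sperms; apply/mapP/and3P => [[w]|[/= nfs fs sp]].
  rewrite mem_sperms => /andP[fw wp] ->; split; last exact: perm_infl Bp wp.
    have [x [y [-> x0 y0]]] := iota_split wp.
    by rewrite infl_split //= sorted_cat_cons /= andbF.
  by rewrite srt.
have [x [y sE]] := far10_split fs nfs.
have wp : perm_eq (defl 1 s) (iota 0 m.+1).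
  by rewrite -(defl_iota 1); apply: perm_defl.
have sK : s = infl 1 [:: 1; 0] (defl 1 s).
  by rewrite sE (deflK Bp (m := m)) // -sE.
by exists (defl 1 s); rewrite // mem_sperms wp -srt // -sK fs.
Qed.

(** * Occurrences in words, and their nesting *)

(* When [occ k s] holds, [mid k s] is the factor of [s] strictly between the
   letters [k] and [k.+1]. *)
Definition mid k (s : seq nat) :=
  take (index k.+1 s - (index k s).+1) (drop (index k s).+1 s).

(** An absent letter has index [size s], so the upper bound says that [k.+1] is present. This is the
    mesh occurrence whose lower value is [k]. *)
Definition occ k (s : seq nat) :=
  (index k s < index k.+1 s < size s) && perm_eq (mid k s) (iota 0 k).

Definition nocc (s : seq nat) := count (occ^~ s) (iota 0 (size s)).

Lemma drop_catD (T : Type) (x y : seq T) n :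
  drop (size x + n) (x ++ y) = drop n y.
Proof. by rewrite addnC -drop_drop drop_size_cat. Qed.

(** Both letters are first met inside [s], so their indices shift by [size x] and the factor between
    them is the same. *)
Lemma occ_infix j x s y : j \in s -> j.+1 \in s -> j \notin x -> j.+1 \notin x ->
  occ j (x ++ s ++ y) = occ j s.
Proof.
move=> js j1s jx j1x.
have indE v : v \in s -> v \notin x ->
    index v (x ++ s ++ y) = size x + index v s.
  by move=> vs vx; rewrite index_cat (negPf vx) index_cat vs.
rewrite /occ /mid !indE // -addnS subnDl drop_catD.
have i1 := js; rewrite -index_mem in i1; have i2 := j1s; rewrite -index_mem in i2.
rewrite !size_cat !ltn_add2l (leq_trans i2) ?leq_addr // i2 !andbT addnS ltn_add2l.
case: ltnP => //= lt_j; rewrite drop_cat (leq_ltn_trans lt_j i2).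
by rewrite takel_cat // size_drop leq_sub2r // ltnW.
Qed.

Lemma occ_mem k s : occ k s -> k.+1 \in s.
Proof. by case/andP => /andP[_]; rewrite index_mem. Qed.

Lemma index_block x t y k : uniq (x ++ (k :: rcons t k.+1) ++ y) ->
  index k (x ++ (k :: rcons t k.+1) ++ y) = size x /\
  index k.+1 (x ++ (k :: rcons t k.+1) ++ y) = size x + (size t).+1.
Proof.
rewrite !cat_cons cat_rcons cat_uniq /= negb_or mem_cat inE cat_uniq /=.
rewrite has_cat /= !negb_or => /and3P[_ /and3P[kx _ /andP[k1x _]] /andP[_]].
case/and3P => _ /andP[k1t _] _.
rewrite !index_cat (negPf kx) (negPf k1x) /= eqxx addn0 index_cat (negPf k1t) /=.
by rewrite eqxx ltn_eqF // addn0.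
Qed.

Lemma mid_block x t y k : uniq (x ++ (k :: rcons t k.+1) ++ y) ->
  mid k (x ++ (k :: rcons t k.+1) ++ y) = t.
Proof.
move=> /index_block[i1 i2]; rewrite /mid i1 i2 -[(size x).+1]addn1 subnDl subn1 /=.
rewrite drop_catD /= drop0 cat_rcons.
by rewrite take_size_cat.
Qed.

Lemma occP k s : uniq s ->
  reflect (exists x t y, s = x ++ (k :: rcons t k.+1) ++ y /\ perm_eq t (iota 0 k))
          (occ k s).
Proof.
move=> Us; apply: (iffP andP) => [[/andP[lt_k k1s] mp]|[x [t [y [sE tp]]]]].
  have ks : k \in s by rewrite -index_mem (ltn_trans lt_k).
  rewrite index_mem in k1s.
  exists (take (index k s) s), (mid k s), (drop (index k.+1 s).+1 s); split=> //.
  rewrite cat_cons cat_rcons -drop_index //.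
  rewrite -{1}(subnK lt_k) -drop_drop /mid cat_take_drop -drop_index //.
  by rewrite cat_take_drop.
rewrite sE in Us *; have [i1 i2] := index_block Us.
rewrite mid_block // i1 i2 tp !size_cat /= size_rcons; split=> //; lia.
Qed.

(** For [j.+1 < k] both letters lie in the middle part, and [occ_infix] applies. For [j.+1 = k]
    neither side has an occurrence: the middle part lacks [k], and in [s] the letter [k] precedes
    [j]. *)
Lemma nocc_mid k s : uniq s -> occ k s ->
  nocc (mid k s) = count (occ^~ s) (iota 0 k).
Proof.
move=> Us /(occP _ Us)[x [t [y [sE tp]]]]; rewrite sE in Us *.
rewrite mid_block // /nocc (perm_size tp) size_iota; apply: eq_in_count => j.
rewrite mem_iota leq0n add0n => jk.
have memt v : (v \in t) = (v < k) by rewrite (perm_mem tp) mem_iota.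
have [j1k|] := ltnP j.+1 k.
  have xN v : v < k -> v \notin rcons x k.
    move=> vk; rewrite mem_rcons inE ltn_eqF //=; apply: contraL Us => vx.
    rewrite cat_uniq; apply/and3P => -[_ /hasPn/(_ v) + _].
    by rewrite mem_cat inE mem_rcons inE memt vk !orbT => /(_ isT); rewrite vx.
  rewrite cat_cons cat_rcons -cat_rcons; symmetry.
  by apply: occ_infix; rewrite ?memt // xN.
move=> kj; have {kj jk} kE : j.+1 = k by lia.
rewrite -kE in memt Us *; apply/idP/idP => [/occ_mem|/andP[/andP[+ _] _]].
  by rewrite memt ltnn.
have [-> _] := index_block Us.
rewrite index_cat; case: ifP => [jx _|_]; last by rewrite ltnNge leq_addr.
move: Us; rewrite cat_uniq => /and3P[_ /hasPn/(_ j)].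
by rewrite mem_cat inE mem_rcons inE memt ltnSn !orbT => /(_ isT); rewrite jx.
Qed.

(** The leading maximum can be neither the lower letter of an occurrence, since [k.+1] is absent,
    nor the upper one, since nothing precedes it. *)
Lemma nocc_cons_max k t : perm_eq t (iota 0 k) -> nocc (k :: t) = nocc t.
Proof.
move=> tp; have memt v : (v \in t) = (v < k) by rewrite (perm_mem tp) mem_iota.
rewrite /nocc [size _]/= (perm_size tp) size_iota -[in iota 0 k.+1]addn1.
rewrite iotaD count_cat /= addn0.
rewrite (_ : occ _ _ = false) ?addn0; last first.
  by apply/negP => /occ_mem; rewrite inE memt; lia.
apply: eq_in_count => j; rewrite mem_iota /= add0n => jk.
have [j1k|kj] := ltnP j.+1 k.
  by rewrite -[k :: t]cat1s -[t in LHS]cats0 occ_infix ?memt ?inE //; lia.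
have <- : j.+1 = k by lia.
rewrite {1}/occ /= eqxx ltn0 /=; apply/esym/negP => /occ_mem.
by rewrite memt; lia.
Qed.

(** * Cutting a king word at an occurrence *)

(** These are the possible middle parts: [path far k t] keeps [t] from starting with its maximum
    [k - 1], and [0 < k] keeps [k] and [k.+1] from being adjacent. *)
Definition kings_nomax k :=
  [seq t <- sperms far k | (0 < k) && path far k t].

Definition block k (t : seq nat) := k :: rcons t k.+1.

Lemma perm_block k t :
  perm_eq (block k t) (iota 0 k.+2) = perm_eq t (iota 0 k).
Proof.
have /permPl-> : perm_eq (block k t) ([:: k; k.+1] ++ t).
  by rewrite /= perm_cons perm_rcons.
rewrite -[in iota 0 k.+2]addn2 iotaD add0n perm_sym perm_catC /= !perm_cons.
exact: perm_sym.
Qed.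

(** For [k > 0] the last letter of [t] is below [k], hence always far from [k.+1]. *)
Lemma path_block k t : perm_eq t (iota 0 k) ->
  path far k (rcons t k.+1) = (0 < k) && path far k t.
Proof.
move=> tp; rewrite rcons_path andbC; case: (posnP k) => [k0|k_gt0].
  by move: tp; rewrite k0 => /perm_small_eq -> .
rewrite andb_idl // => _; have := perm_mem tp; have := perm_size tp.
rewrite size_iota; case: t {tp} => [|a t] sz memt; first by rewrite -sz in k_gt0.
have := mem_last a t; rewrite memt mem_iota /far /=; lia.
Qed.

Lemma mid_infl k t w m : perm_eq t (iota 0 k) -> perm_eq w (iota 0 m.+1) ->
  mid k (infl k.+1 (block k t) w) = t.
Proof.
move=> tp wp; have Bp := etrans (perm_block k t) tp.
have := perm_uniq (perm_infl Bp wp); rewrite iota_uniq.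
have [x [y [-> x0 y0]]] := iota_split wp; rewrite infl_split //.
exact: mid_block.
Qed.

Lemma occ_infl k t w m : perm_eq t (iota 0 k) -> perm_eq w (iota 0 m.+1) ->
  occ k (infl k.+1 (block k t) w).
Proof.
move=> tp wp; have Bp := etrans (perm_block k t) tp.
have := perm_uniq (perm_infl Bp wp); rewrite iota_uniq.
have [x [y [-> x0 y0]]] := iota_split wp; rewrite infl_split // => Us.
apply/occP => //; exists [seq k.+1 + v | v <- x], t, [seq k.+1 + v | v <- y].
by [].
Qed.

Lemma sorted_infl_block k t w m : perm_eq t (iota 0 k) -> perm_eq w (iota 0 m.+1) ->
  (0 < k) && path far k t ->
  sorted far (infl k.+1 (block k t) w) = sorted far10 w.
Proof.
move=> tp wp kt; apply: (sorted_infl _ wp).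
- by rewrite path_block.
- by move=> v v' v0 v'0; rewrite /far10 /far; lia.
- by move=> v v0; rewrite /far10 /far; lia.
- by move=> v v0; rewrite last_rcons /far10 /far; lia.
Qed.

(** The inverse map sends [s] to [mid k s] and [defl k.+1 s]. The block has [k.+2] letters and
    shrinks to one, which accounts for the sizes. *)
Lemma perm_occ_sperms k m :
  perm_eq [seq s <- sperms far (k.+1 + m.+1) | occ k s]
    [seq infl k.+1 (block k t) w | t <- kings_nomax k, w <- sperms far10 m.+1].
Proof.
apply: uniq_perm.
- by rewrite filter_uniq // sperms_uniq.
- apply: allpairs_uniq; rewrite ?filter_uniq ?permutations_uniq //.
  move=> _ _ /allpairsP[[t w] /= [+ + ->]] /allpairsP[[t' w'] /= [+ + ->]] /=.
  rewrite !mem_filter !mem_permutations => /and3P[_ _ tp] /andP[_ wp].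
  move=> /and3P[_ _ tp'] /andP[_ wp'] eq_infl.
  have := congr1 (mid k) eq_infl; rewrite (mid_infl tp wp) (mid_infl tp' wp') => tt'.
  have := congr1 (defl k.+1) eq_infl; rewrite !inflK ?perm_block //.
  by rewrite tt' => ->.
move=> s; rewrite mem_filter mem_sperms.
apply/and3P/allpairsP => [[os fs sp]|[[t w] /= [+ + ->]]]; last first.
  rewrite !mem_filter !mem_permutations => /and3P[kt _ tp] /andP[fw wp].
  rewrite (occ_infl tp wp) (sorted_infl_block tp wp kt) fw.
  by split=> //; apply: perm_infl; rewrite ?perm_block.
have Us : uniq s by rewrite (perm_uniq sp) iota_uniq.
have [x [t [y [sE tp]]]] := occP _ Us os.
have wp : perm_eq (defl k.+1 s) (iota 0 m.+1).
  by rewrite -(defl_iota k.+1); apply: perm_defl.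
have sK : infl k.+1 (block k t) (defl k.+1 s) = s.
  by rewrite sE (deflK (m := m)) ?perm_block // -sE.
have [_ kt _] : [/\ sorted far (rcons x k), path far k (rcons t k.+1)
               & path far (last k (rcons t k.+1)) y].
  by apply/and3P; rewrite -sorted_cat_block -sE.
rewrite path_block // in kt.
exists (t, defl k.+1 s); rewrite /= !mem_filter !mem_permutations wp tp kt.
rewrite sK -(sorted_infl_block tp wp kt) sK fs; split=> //=; rewrite andbT.
by case/andP: kt => _ /path_sorted.
Qed.

Lemma perm_cons_max n t :
  perm_eq (n :: t) (iota 0 n.+1) = perm_eq t (iota 0 n).
Proof.
rewrite -[in iota 0 n.+1]addn1 iotaD add0n perm_sym perm_catC /= perm_cons.
exact: perm_sym.
Qed.

(** * Weighted sums over king words *)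

Section Sums.
Variables (S : comNzRingType) (u : S).
Local Open Scope ring_scope.

Definition wt (r : seq (seq nat)) : S := \sum_(s <- r) u ^+ nocc s.

Lemma sum_occ k m :
  \sum_(s <- sperms far (k.+1 + m.+1) | occ k s) u ^+ nocc (mid k s) =
  wt (kings_nomax k) * (size (sperms far10 m.+1))%:R.
Proof.
rewrite -big_filter (perm_big _ (perm_occ_sperms k m)) /= big_allpairs_dep /=.
rewrite /wt mulr_suml big_seq [RHS]big_seq; apply: eq_bigr => t.
rewrite mem_filter mem_sperms => /and3P[_ _ tp].
rewrite (@eq_big_seq _ _ _ _ _ _ (fun=> u ^+ nocc t)).
  by rewrite big_const_seq count_predT iter_addr_0 mulr_natr.
by move=> w; rewrite mem_sperms => /andP[_ wp]; rewrite (mid_infl tp wp).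
Qed.

(** A telescoping sum: when [P k] holds, passing from [k] to [k.+1] multiplies the power by [u], an
    increment of [u - 1] times the old power; otherwise nothing changes. *)
Lemma expr_count (P : pred nat) n :
  u ^+ count P (iota 0 n) =
  1 + (u - 1) * \sum_(k < n | P k) u ^+ count P (iota 0 k).
Proof.
elim: n => [|n IHn]; first by rewrite big_ord0 mulr0 addr0.
rewrite -[in LHS]addn1 iotaD count_cat /= addn0 exprD add0n.
rewrite big_mkcond big_ord_recr /= mulrDr addrA.
rewrite -(big_mkcond (fun k : 'I_n => P k) (fun k => u ^+ count P (iota 0 k))) -IHn.
by case: (P n); rewrite ?expr1 ?expr0; ring.
Qed.

(* Occurrences are nested, so the one at [k] has [nocc (mid k s)] others inside. *)
Lemma expr_nocc s : uniq s ->
  u ^+ nocc s =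
  1 + (u - 1) * \sum_(k < size s | occ k s) u ^+ nocc (mid k s).
Proof.
move=> Us; rewrite {1}/nocc expr_count; congr (_ + _ * _).
by apply: eq_bigr => k ok; rewrite -nocc_mid.
Qed.

(** Sum [expr_nocc] over the king words, exchange the two sums, and evaluate the inner one by
    [sum_occ]. *)
Lemma wt_sperms n :
  wt (sperms far n) = (size (sperms far n))%:R
    + (u - 1) * \sum_(k < n) wt (kings_nomax k) *
        (if (n - k.+1)%N is 0 then 0%N else size (sperms far10 (n - k.+1)))%:R.
Proof.
have eqs s : s \in sperms far n -> u ^+ nocc s =
    1 + (u - 1) * \sum_(k < n) (if occ k s then u ^+ nocc (mid k s) else 0).
  rewrite mem_sperms => /andP[_ sp]; rewrite expr_nocc ?(perm_uniq sp) ?iota_uniq //.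
  by rewrite (perm_size sp) size_iota big_mkcond.
rewrite /wt (eq_big_seq _ eqs) big_split /=; congr (_ + _).
  by rewrite big_const_seq count_predT iter_addr_0.
rewrite -mulr_sumr exchange_big /=; congr (_ * _); apply: eq_bigr => k _.
rewrite -big_mkcond /=; case nk: (n - k.+1)%N => [|m]; last first.
  by have := sum_occ k m; rewrite -nk subnKC.
(* Here [k.+1 = n] is not a letter of [s], so there is no occurrence at [k]; this is why the factor
   is set to 0. *)
rewrite mulr0 big_seq_cond big1 // => s /andP[].
rewrite mem_sperms => /andP[_ sp] /occ_mem.
by rewrite (perm_mem sp) mem_iota; lia.
Qed.

(** A king word on [0, ..., n] fails [path far n.+1] exactly when it starts with [n]; deleting [n]
    leaves a word not starting with [n - 1] and keeps [nocc]. For [n = 0] the empty word remains,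
    which [kings_nomax 0] excludes. *)
Lemma wt_sperms_first n :
  wt (sperms far n.+1) = wt (kings_nomax n.+1) +
    (if n is 0 then 1 else wt (kings_nomax n)).
Proof.
rewrite /wt (bigID (path far n.+1)) /= -[in LHS]big_filter; congr (_ + _).
rewrite -big_filter.
have /(perm_big _) -> : perm_eq
    [seq s <- sperms far n.+1 | ~~ path far n.+1 s]
    [seq n :: t | t <- sperms far n & path far n t].
  apply: uniq_perm; first by rewrite filter_uniq // sperms_uniq.
    by rewrite map_inj_uniq => [|t t' []//]; rewrite filter_uniq // sperms_uniq.
  move=> s; rewrite mem_filter mem_sperms; apply/and3P/mapP; last first.
    move=> [t]; rewrite mem_filter mem_sperms => /and3P[nt ft tp] ->.
    rewrite /= nt; split=> //; first by rewrite /far; lia.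
    by rewrite perm_cons_max.
  case: s => [|a t] [nfs fs sp]; first by have := perm_size sp.
  have an : a = n.
    have := perm_mem sp a; rewrite mem_head mem_iota.
    by move: nfs; rewrite /= negb_and (fs : path far a t) orbF /far; lia.
  rewrite an /= in fs sp *; exists t => //.
  by rewrite mem_filter mem_sperms -perm_cons_max sp fs (path_sorted fs).
rewrite big_map big_filter big_seq_cond.
rewrite (eq_bigr (fun t => u ^+ nocc t)); last first.
  by move=> t; rewrite mem_sperms => /andP[/andP[_ tp] _]; rewrite nocc_cons_max.
rewrite -big_seq_cond -big_filter /kings_nomax; case: n => [|n] //.
by rewrite big_seq1.
Qed.
End Sums.

(** * From permutations and the mesh pattern to words *)

Definition word n (s : 'S_n) : seq nat := [seq (s i : nat) | i <- enum 'I_n].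

Lemma size_word n (s : 'S_n) : size (word s) = n.
Proof. by rewrite size_map size_enum_ord. Qed.

Lemma nth_word n (s : 'S_n) (i : 'I_n) : nth 0 (word s) i = s i.
Proof. by rewrite (nth_map i) ?size_enum_ord // nth_ord_enum. Qed.

Lemma word_inj n : injective (@word n).
Proof.
by move=> s s' ss; apply/permP => i; apply: val_inj; rewrite /= -!nth_word ss.
Qed.

Lemma word_uniq n (s : 'S_n) : uniq (word s).
Proof. by rewrite map_inj_uniq ?enum_uniq // => i j /val_inj/perm_inj. Qed.

Lemma perm_word n (s : 'S_n) : perm_eq (word s) (iota 0 n).
Proof.
apply: uniq_perm; rewrite ?word_uniq ?iota_uniq //.
have sub : {subset word s <= iota 0 n}.
  by move=> v /mapP[i _ ->]; rewrite mem_iota /=.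
by have [] := uniq_min_size (word_uniq s) sub; rewrite ?size_word ?size_iota.
Qed.

(** [word] is injective with values among these permutations, and both lists have n! elements. *)
Lemma perm_words n : perm_eq [seq word s | s <- enum 'S_n] (permutations (iota 0 n)).
Proof.
have Uw : uniq [seq word s | s <- enum 'S_n].
  by rewrite map_inj_uniq ?enum_uniq //; apply: word_inj.
apply: uniq_perm; rewrite ?permutations_uniq //.
have sub : {subset [seq word s | s <- enum 'S_n] <= permutations (iota 0 n)}.
  by move=> w /mapP[s _ ->]; rewrite mem_permutations perm_word.
have [] // := uniq_min_size Uw sub.
by rewrite size_map -cardE card_Sn size_permutations ?iota_uniq // size_iota.
Qed.

Lemma farE x y : far x y = (1 < `|y%:Z - x%:Z|)%R.
Proof. by rewrite /far; lia. Qed.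

Lemma king_word n (s : 'S_n) : king s = sorted far (word s).
Proof.
apply/forallP/(sortedP 0) => [ks i | fs i].
  rewrite size_word => i1n.
  have /forallP/(_ (Ordinal i1n))/implyP/(_ (eqxx _)) := ks (Ordinal (ltnW i1n)).
  rewrite -[i.+1]/(val (Ordinal i1n)) nth_word -[i]/(val (Ordinal (ltnW i1n))).
  by rewrite nth_word farE.
apply/forallP => j; apply/implyP => /eqP ji.
have := fs i; rewrite size_word -ji !nth_word => /(_ (ltn_ord _)).
by rewrite farE.
Qed.

Lemma index_word n (s : 'S_n) (i : 'I_n) : index ((s i : nat)) (word s) = i.
Proof. by rewrite -nth_word index_uniq ?word_uniq ?size_word. Qed.

Lemma mem_slice (T : eqType) (w : seq T) a b v : uniq w -> v \in w -> a <= b ->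
  (v \in take (b - a) (drop a w)) = (a <= index v w < b).
Proof.
rewrite -{1 2 4 5}(cat_take_drop a w) mem_cat cat_uniq => /and3P[_ /hasPn tdN _].
have [vt _ ab|vt /= vd ab] := boolP (v \in take a w).
  rewrite cat_take_drop leqNgt (index_ltn vt) /=; apply/negP => /mem_take/tdN.
  by rewrite /= vt.
have aw : a < size w by rewrite ltnNge; apply: contraL vd => /drop_oversize->.
rewrite in_take // index_cat (negPf vt) size_takel ?(ltnW aw) // leq_addr /=.
by rewrite ltn_subRL.
Qed.

Lemma forall_shading (F : nat -> nat -> bool) :
  [forall b in shading, F b.1 b.2] =
  [&& F 0 0, F 0 1, F 1 1, F 1 2, F 2 0 & F 2 1].
Proof.
apply/forall_inP/and5P => [Fs | [F00 F01 F11 F12 /andP[F20 F21]] b].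
  have FE x y : x < 3 -> y < 3 -> box x y \in shading -> F x y.
    by move=> x3 y3 /Fs; rewrite /= !inordK.
  by split; rewrite ?FE ?inE ?eqxx ?orbT.
by rewrite !inE -!orbA => /or4P[/eqP->|/eqP->|/eqP->|/or3P[/eqP->|/eqP->|/eqP->]];
  rewrite /= !inordK.
Qed.

(** The fully shaded middle row forces consecutive values. The remaining boxes of the middle column
    leave only smaller entries there, and boxes (0,0) and (2,0) leave no smaller entry elsewhere. *)
Lemma mesh12_occ_shading n (s : 'S_n) (i j : 'I_n) :
  mesh12_occ shading s i j <->
  [/\ i < j, s j = (s i).+1 :> nat & forall m : 'I_n, (i < m < j) = (s m < s i)].
Proof.
rewrite /mesh12_occ (forall_shading (fun x y => [forall m : 'I_n,
     ~~ ((mesh_line i j x < m.+1 < mesh_line i j x.+1) &&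
         (mesh_line (s i) (s j) y < (s m).+1 < mesh_line (s i) (s j) y.+1))])).
have eqs (m m' : 'I_n) : (s m == s m' :> nat) = (m == m' :> nat).
  exact: (inj_eq (@perm_inj _ s)).
rewrite /mesh_line /=; split.
  case/and3P => ij sij /and5P[/forallP h00 /forallP h01 /forallP h11 /forallP h12].
  case/andP => /forallP h20 /forallP h21.
  have sj : s j = (s i).+1 :> nat.
    have := ltn_ord (s j); move: (sij); rewrite leq_eqVlt => /predU1P[//|sij1 sjn].
    (* The position of the value just above [s i]: if that value were below [s j], it would lie in
       the shaded middle row. *)
    pose m := (s^-1)%g (Ordinal (ltn_trans sij1 sjn)).
    have sm : s m = (s i).+1 :> nat by rewrite /m permKV.
    have := h01 m; have := h11 m; have := h21 m; rewrite sm.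
    have := eqs m i; have := eqs m j; have := ltn_ord m; rewrite sm; lia.
  split=> // m; have := eqs m i; have := eqs m j.
  have := h00 m; have := h11 m; have := h12 m; have := h20 m.
  by have := ltn_ord m; have := ltn_ord (s m); lia.
case=> ij sj memE; apply/and3P; split; rewrite ?sj //.
apply/and5P; split; last (apply/andP; split); apply/forallP => m;
  have := memE m; have := ltn_ord (s m); have := eqs m i; have := eqs m j; lia.
Qed.

Lemma occ_word n (s : 'S_n) (i j : 'I_n) :
  mesh12_occ shading s i j <-> occ (s i) (word s) /\ s j = (s i).+1 :> nat.
Proof.
rewrite mesh12_occ_shading /occ /mid index_word size_word; split.
  case=> ij sj memE; split=> //; rewrite -sj index_word ij ltn_ord /=.
  apply: uniq_perm; rewrite ?iota_uniq ?take_uniq ?drop_uniq ?word_uniq //.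
  move=> v; have [vw|vw] := boolP (v \in word s); last first.
    rewrite (_ : (v \in take _ _) = false); last first.
      by apply/negP => /mem_take/mem_drop; apply/negP.
    apply/esym/negP; rewrite mem_iota => vi.
    move: vw; rewrite (perm_mem (perm_word s)) mem_iota.
    by have := ltn_ord (s i); lia.
  rewrite mem_slice ?word_uniq //; case/mapP: vw => m _ ->.
  by rewrite index_word memE mem_iota.
move=> [+ sj]; rewrite -sj index_word => /andP[/andP[ij _] /perm_mem memE].
split=> // m; have := memE (s m); rewrite mem_iota /= => <-.
rewrite mem_slice ?word_uniq ?index_word //.
by apply: (map_f (fun i => s i : nat)); rewrite mem_enum.
Qed.

Lemma count_iota (P : pred nat) n : count P (iota 0 n) = #|[pred i : 'I_n | P i]|.
Proof. by rewrite -sum1_count -sum1_card -[in iota 0 n](subn0 n) big_mkord. Qed.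

(** An occurrence is determined by its lower value, because the upper one is its successor; so pairs
    of positions correspond to values [k] with [occ k]. *)
Lemma mesh12_count_word n (s : 'S_n) : mesh12_count shading s = nocc (word s).
Proof.
rewrite /nocc size_word count_iota /mesh12_count.
rewrite -(card_in_imset (f := fun x : 'I_n * 'I_n => s x.1)).
  apply: eq_card => k; rewrite inE; apply/imsetP/idP => [[[i j]]|ok].
    by rewrite inE => /occ_word[/= oi _] ->.
  have := occ_mem ok; rewrite (perm_mem (perm_word s)) mem_iota => k1n.
  exists ((s^-1)%g k, (s^-1)%g (Ordinal k1n)); last by rewrite /= permKV.
  by rewrite inE; apply/occ_word; rewrite /= !permKV.
move=> [i j] [i' j']; rewrite !inE => /occ_word[/= _ sj] /occ_word[/= _ sj'] sii'.
have ii' := perm_inj sii'; rewrite -{}ii' in sj' *.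
by congr (_, _); apply/(@perm_inj _ s)/val_inj; rewrite /= sj sj'.
Qed.

Local Open Scope ring_scope.

Lemma sum_kings (V : nmodType) n (F : seq nat -> V) :
  \sum_(s in kings n) F (word s) = \sum_(w <- sperms far n) F w.
Proof.
rewrite /sperms big_filter -(perm_big _ (perm_words n)) big_map big_enum_cond /=.
by apply: eq_bigl => s; rewrite inE king_word.
Qed.

Lemma card_kings n : #|kings n| = size (sperms far n).
Proof. by rewrite -sum1_card (sum_kings n (fun=> 1%N)) sum1_size. Qed.

(** * Coefficients of formal power series *)

Section FpsCoef.
Variable S : comNzRingType.
Implicit Types f g : fps S.

Lemma fps_coefD f g n : fps_coef (f + g) n = fps_coef f n + fps_coef g n.
Proof. by []. Qed.

Lemma fps_coefB f g n : fps_coef (f - g) n = fps_coef f n - fps_coef g n.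
Proof. by []. Qed.

Lemma fps_coef1 n : fps_coef (1 : fps S) n = (n == 0%N)%:R.
Proof. by []. Qed.

Lemma fps_coefM f g n :
  fps_coef (f * g) n = \sum_(i < n.+1) fps_coef f i * fps_coef g (n - i).
Proof. by []. Qed.

Lemma fps_coefCM c f n : fps_coef (fpsC c * f) n = c * fps_coef f n.
Proof.
rewrite fps_coefM big_ord_recl /= subn0 big1 ?addr0 // => i _.
exact: mul0r.
Qed.

Lemma fps_coefXM f n :
  fps_coef (fpsX S * f) n = if n is m.+1 then fps_coef f m else 0.
Proof.
rewrite fps_coefM; case: n => [|n]; first by rewrite big_ord1 mul0r.
rewrite !big_ord_recl /= mul0r add0r mul1r subSS subn0 big1 ?addr0 // => i _.
exact: mul0r.
Qed.

Lemma fpsC1 : fpsC 1 = 1 :> fps S.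
Proof. by apply: fpsP => -[]. Qed.

Lemma fpsC0 : fpsC 0 = 0 :> fps S.
Proof. by apply: fpsP => -[]. Qed.

Lemma fpsCB c d : fpsC (c - d) = fpsC c - fpsC d :> fps S.
Proof. by apply: fpsP => -[|n] //; rewrite fps_coefB /= subr0. Qed.

End FpsCoef.

(** * Functional equations and their solution *)

Section GeneratingFunctions.
Variables (S : comUnitRingType) (u : S).
Let t : fps S := fpsX S.
Let A : fps S := A_series S.

(** Keeping the ring and [u] arbitrary lets the indeterminate give [E] and the value 0 give [P]. *)
Definition W_series : fps S := FPS (fun n => wt u (sperms far n)).
Definition M_series : fps S := FPS (fun k => wt u (kings_nomax k)).
(** The constant term is 0 because a contracted word contains at least the letter 0 that stands for
    the block. *)
Definition Q_series : fps S :=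
  FPS (fun m => (if m is 0 then 0%N else size (sperms far10 m))%:R).

Lemma W_seriesE : W_series = A + (fpsC u - 1) * (t * (M_series * Q_series)).
Proof.
rewrite -fpsC1 -fpsCB; apply: fpsP => n.
rewrite fps_coefD fps_coefCM fps_coefXM /= wt_sperms card_kings.
congr (_ + _ * _); case: n => [|n]; first by rewrite big_ord0.
by apply: eq_bigr => k _; rewrite subSS.
Qed.

Lemma W_series_M : W_series = (1 + t) * (1 + M_series).
Proof.
apply: fpsP => n; rewrite mulrDl mul1r fps_coefD fps_coefXM fps_coefD fps_coef1 /=.
case: n => [|n].
  by rewrite addr0 /wt big_seq1 big_nil addr0.
rewrite wt_sperms_first add0r; congr (_ + _).
by case: n => [|n] /=; rewrite ?add0r // /wt big_nil addr0.
Qed.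

Lemma Q_seriesE : Q_series = A - 1 + t * Q_series.
Proof.
apply: fpsP => n; rewrite fps_coefD fps_coefB fps_coefXM fps_coef1 /= card_kings.
case: n => [|[|n]]; rewrite ?subrr ?addr0 ?subr0 //.
by rewrite size_sperms_far10 natrD.
Qed.

Lemma W_series_closed :
  W_series = ((1 + t) * (t * (1 - fpsC u) - (1 - fpsC u * t) * A))
             / (- 1 + t * (1 - fpsC u + t - (1 - fpsC u) * A)).
Proof.
set D := - 1 + _.
have DU : D \is a GRing.unit.
  rewrite fps_unitE /D fps_coefD fps_coefXM addr0.
  by rewrite (_ : fps_coef _ 0 = -1) // unitrN1.
apply: (canRL (mulrK DU)); rewrite /D.
have e := W_seriesE; rewrite W_series_M in e; rewrite W_series_M.
(* Everything is expressed through [Q], with A = (1 - t) Q + 1. *)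
have AE : A = Q_series - t * Q_series + 1.
  by rewrite {1}Q_seriesE; ring.
rewrite AE in e *; apply/eqP; rewrite -subr_eq0; apply/eqP.
move: e; set M := M_series; set Q := Q_series; set v := fpsC u => /eqP.
rewrite -subr_eq0 => /eqP e.
(* The denominator is now -(1 - t)(1 + t + (1 - v) t Q), whose last factor is the coefficient of [M]
   in [e]; with the factor 1 + t of [W_series_M] this gives the multiplier. *)
rewrite -[RHS](mulr0 (- ((1 - t) * (1 + t)))) -e; ring.
Qed.

End GeneratingFunctions.

(** * The series of the theorem and their initial terms *)

Lemma E_series_wt : E_series shading = W_series ('X : {poly int}).
Proof.
apply: fpsP => n /=; rewrite /wt -sum_kings.
by apply: eq_bigr => s _; rewrite mesh12_count_word.
Qed.

(** At [u = 0] a power of [u] is 1 for exponent 0 and vanishes otherwise, so only avoiders count. *)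
Lemma P_series_wt : P_series int shading = W_series (0 : int).
Proof.
apply: fpsP => n /=; rewrite /wt -sum_kings -sum1_card natr_sum.
rewrite big_mkcond [RHS]big_mkcond; apply: eq_bigr => s _.
rewrite inE mesh12_count_word; case: (s \in kings n) => //=.
by rewrite expr0n; case: eqP.
Qed.

(** A closed term made for evaluation: the distribution of [nocc] over the values 0, 1, 2, and a
    check that no larger value arises. *)
Definition profile n := let l := [seq nocc w | w <- sperms far n] in
  ([:: count_mem 0%N l; count_mem 1%N l; count_mem 2%N l], all (gtn 3) l).

Lemma wt_profile (S : comNzRingType) (u : S) n a b c :
  profile n = ([:: a; b; c], true) ->
  wt u (sperms far n) = a%:R + b%:R * u + c%:R * u ^+ 2.
Proof.
case=> <- <- <-; rewrite /wt.
elim: (sperms far n) => [|w r IHr] /= ; first by rewrite big_nil => _; ring.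
case/andP => w3 /IHr; rewrite big_cons => ->; rewrite !natrD.
by case: (nocc w) w3 => [|[|[|]]] //= _; rewrite ?expr0 ?expr1; ring.
Qed.

Theorem theorem4p6 :
  [/\ (let t : fps int := fpsX int in
       let A : fps int := A_series int in
       P_series int shading
         = ((1 + t) * (A - t)) / (1 + t * (A - t - 1))),
      (let t : fps {poly int} := fpsX {poly int} in
       let u : fps {poly int} := fpsC ('X : {poly int}) in
       let A : fps {poly int} := A_series {poly int} in
       E_series shading
         = ((1 + t) * (t * (1 - u) - (1 - u * t) * A))
             / (- 1 + t * (1 - u + t - (1 - u) * A)))
    & (let u : {poly int} := 'X in
       [seq fps_coef (E_series shading) n | n <- iota 0 9]
         = [:: 1; 1; 0; 0; 2; 14; 88 + 2 * u; 632 + 14 * u;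
               5152 + 88 * u + 2 * u ^+ 2])].
Proof.
split.
- move=> t A; rewrite P_series_wt W_series_closed fpsC0.
  (* At [u = 0] the closed form has both numerator and denominator negated. *)
  by rewrite -[in RHS]mulrNN -invrN; congr (_ / _); rewrite /t /A; ring.
- by rewrite E_series_wt W_series_closed.
move=> u; rewrite E_series_wt /= -/u.
congr [:: _; _; _; _; _; _; _; _; _].
(* In each line the size comes first, then the numbers of king words with 0, 1 and 2 occurrences,
   found by enumerating all words of that size. *)
- by rewrite (@wt_profile _ _ 0 1 0 0) ?mul0r ?addr0 //; vm_compute.
- by rewrite (@wt_profile _ _ 1 1 0 0) ?mul0r ?addr0 //; vm_compute.
- by rewrite (@wt_profile _ _ 2 0 0 0) ?mul0r ?addr0 //; vm_compute.
- by rewrite (@wt_profile _ _ 3 0 0 0) ?mul0r ?addr0 //; vm_compute.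
- by rewrite (@wt_profile _ _ 4 2 0 0) ?mul0r ?addr0 //; vm_compute.
- by rewrite (@wt_profile _ _ 5 14 0 0) ?mul0r ?addr0 //; vm_compute.
- by rewrite (@wt_profile _ _ 6 88 2 0) ?mul0r ?addr0 //; vm_compute.
- by rewrite (@wt_profile _ _ 7 632 14 0) ?mul0r ?addr0 //; vm_compute.
- by rewrite (@wt_profile _ _ 8 5152 88 2) ?mul0r ?addr0 //; vm_compute.
Qed.
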